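(* Let $A$ and $B$ be commutative rings, $f : A \longrightarrow B$ a ring homomorphism, $J$ an ideal of $B$, and $I$ a nonzero proper ideal of $A$. Then $I \bowtie_J B$ is an sdf-absorbing ideal of $A \bowtie_J B$ if and only if $I$ is an sdf-absorbing ideal of $A$.
   Context: All rings are commutative with identity $1 \neq 0$, and ring homomorphisms satisfy $f(1) = 1$. A proper ideal $I$ of a commutative ring $R$ is a square-difference factor absorbing ideal (sdf-absorbing ideal) of $R$ if whenever $a, b \in R$ are both nonzero and $a^2 - b^2 \in I$, then $a + b \in I$ or $a - b \in I$. The amalgamation of $A$ and $B$ with respect to $f$ along $J$ is the subring $A \bowtie_J B = \{(a, f(a) + j) \mid a \in A, j \in J\}$ of $A \times B$. For an ideal $I$ of $A$, $I \bowtie_J B = \{(i, f(i) + j) \mid i \in I, j \in J\}$, which is an ideal of $A \bowtie_J B$. *)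

(* Defs.v *)
From HB Require Import structures.
From mathcomp Require Import all_boot all_algebra.
From mathcomp Require Import boolp classical_sets.

Set Implicit Arguments.
Unset Strict Implicit.
Unset Printing Implicit Defensive.

Import GRing.Theory.
Local Open Scope ring_scope.
Local Open Scope classical_set_scope.

(* Ideals may be improper here, unlike those of [ring_quotient]. *)
Definition is_ideal (R : comNzRingType) (I : set R) : Prop :=
  [/\ I 0,
      (forall x y, I x -> I y -> I (x + y))
    & (forall a x, I x -> I (a * x))].

Definition is_proper_ideal (R : comNzRingType) (I : set R) : Prop :=
  is_ideal I /\ I <> setT.

Definition sdf_absorbing (R : comNzRingType) (I : set R) : Prop :=
  is_proper_ideal I /\
  (forall a b : R, a <> 0 -> b <> 0 ->
     I (a ^+ 2 - b ^+ 2) -> I (a + b) \/ I (a - b)).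

Definition graph_sum (A B : comNzRingType) (f : {rmorphism A -> B})
    (I : set A) (J : set B) : set (A * B)%type :=
  [set (i, f i + j) | i in I & j in J].

Section Amalgamation.
Variables (A B : comNzRingType) (f : {rmorphism A -> B}).
Variables (J : set B) (idJ : is_ideal J).

(* The proof [idJ] is an argument, although the predicate does not depend on
   it, so that the subring structure below can be inferred. *)
Definition amalg_pred of is_ideal J : pred (A * B)%type :=
  fun x => x \in graph_sum f setT J.

Fact amalg_subring_closed : subring_closed (amalg_pred idJ).
Proof.
have [J0 JD JM] := idJ.
have JN x : J x -> J (- x) by move=> Jx; rewrite -mulN1r; apply: JM.
split.
- by apply/mem_set; exists 1 => //; exists 0 => //; rewrite rmorph1 addr0.
- move=> _ _ /set_mem[a _ [j Jj <-]] /set_mem[b _ [k Jk <-]].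
  apply/mem_set; exists (a - b) => //; exists (j - k); first by apply/JD/JN.
  by congr (_, _); rewrite /= rmorphB opprD addrACA.
- move=> _ _ /set_mem[a _ [j Jj <-]] /set_mem[b _ [k Jk <-]].
  apply/mem_set; exists (a * b) => //.
  exists (f a * k + (f b * j + j * k)); last first.
    congr (_, _); rewrite /= rmorphM mulrDl !mulrDr !addrA.
    by rewrite [f b * j]mulrC.
  by apply: (JD); [exact: JM|apply: JD; exact: JM].
Qed.

HB.instance Definition _ :=
  GRing.isSubringClosed.Build (A * B)%type (amalg_pred idJ)
    amalg_subring_closed.

Definition amalg : Type := {x : A * B | amalg_pred idJ x}.

HB.instance Definition _ := SubChoice.on amalg.
HB.instance Definition _ :=
  [SubChoice_isSubComNzRing of amalg by <:].

Definition amalg_ideal (I : set A) : set amalg :=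
  [set x : amalg | graph_sum f I J (val x)].

End Amalgamation.

Arguments amalg {A B} f {J} idJ.
Arguments amalg_ideal {A B} f {J} idJ I.

(* Main.v *)
Require Import Defs.
From mathcomp Require Import all_boot all_algebra.
From mathcomp Require Import boolp classical_sets.
Local Open Scope ring_scope.
Local Open Scope classical_set_scope.

Import GRing.Theory.
Set Implicit Arguments.
Unset Strict Implicit.

(** The first projection [p] from the amalgamation to [A] is a surjective ring
    morphism, split by [a |-> (a, f a)], and the ideal attached to [I] is
    exactly the preimage of [I] under [p] ([amalg_idealE]). Both absorbing
    properties therefore speak about the same elements of [A]; the forward
    direction evaluates the property at the pairs [(a, f a)].

    The one obstacle to the converse is that a nonzero element [(0, j)] of the
    amalgamation projects to [0], where the definition of an sdf-absorbing
    ideal says nothing. This is where [I] must be nonzero: a nonzero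
    sdf-absorbing ideal is radical ([sdf_absorbing_sqr]), so that it absorbs
    differences of squares of arbitrary elements ([sdf_absorbing_all]). *)

Lemma is_idealN (R : comNzRingType) (I : set R) (x : R) :
  is_ideal I -> I x -> I (- x).
Proof. by case=> _ _ IM Ix; rewrite -mulN1r; apply: IM. Qed.

Lemma is_proper_idealP (R : comNzRingType) (I : set R) :
  is_proper_ideal I <-> is_ideal I /\ ~ I 1.
Proof.
split=> -[idI prI]; split=> //.
- move=> I1; apply: prI; apply/seteqP; split=> // x _.
  by case: idI => _ _ IM; rewrite -[x]mulr1; apply: IM.
- by move=> IT; apply: prI; rewrite IT.
Qed.

Lemma ideal_nonzero_elt (R : comNzRingType) (I : set R) :
  is_ideal I -> I <> [set 0] -> exists2 i, I i & i <> 0.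
Proof.
move=> [I0 _ _] nzI; apply: contrapT => noI; apply: nzI.
apply/seteqP; split=> [x Ix|_ ->//].
by apply: contrapT => nz_x; apply: noI; exists x.
Qed.

(** A nonzero [i] in [I] is congruent to [0] but may be used where [0] may
    not: [i ^+ 2 - x ^+ 2] lies in [I], hence so does [i + x] or [i - x]. *)
Lemma sdf_absorbing_sqr (R : comNzRingType) (I : set R) (x : R) :
  sdf_absorbing I -> I <> [set 0] -> I (x ^+ 2) -> I x.
Proof.
move=> [[idI _] sdfI] nzI Ix2; have [I0 ID IM] := idI.
have [->//|/eqP nz_x] := eqVneq x 0.
have [i Ii nz_i] := ideal_nonzero_elt idI nzI.
have : I (i ^+ 2 - x ^+ 2) by apply: ID; [exact: IM | exact: is_idealN].
case/(sdfI i x nz_i nz_x) => Iix.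
- by rewrite -[x](addKr i); apply: ID => //; apply: is_idealN.
- by rewrite -[x](subKr i); apply: ID => //; apply: is_idealN.
Qed.

Lemma sdf_absorbing_all (R : comNzRingType) (I : set R) (a b : R) :
  sdf_absorbing I -> I <> [set 0] ->
  I (a ^+ 2 - b ^+ 2) -> I (a + b) \/ I (a - b).
Proof.
move=> sdfI nzI; have [[idI _] abI] := sdfI.
have [->|/eqP nz_a] := eqVneq a 0.
  rewrite expr0n /= sub0r add0r => /(is_idealN idI); rewrite opprK.
  by move/(sdf_absorbing_sqr sdfI nzI); left.
have [->|/eqP nz_b] := eqVneq b 0; last exact: abI.
rewrite expr0n /= subr0 addr0.
by move/(sdf_absorbing_sqr sdfI nzI); left.
Qed.

Section Projection.
Variables (A B : comNzRingType) (f : {rmorphism A -> B}).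
Variables (J : set B) (idJ : is_ideal J).

(** The value of [x : amalg f idJ] has the form [(a, f a + j)] with [j] in [J],
    so only its first component decides membership. *)
Lemma amalg_idealE (I : set A) (x : amalg f idJ) :
  amalg_ideal f idJ I x <-> I (val x).1.
Proof.
split; first by case=> i Ii [j _ <-].
rewrite /amalg_ideal /=; have /set_mem[a _ [j Jj <-]] := valP x => Ia.
by exists a => //; exists j.
Qed.

Lemma amalg_graph_subproof (a : A) : amalg_pred f idJ (a, f a).
Proof.
have [J0 _ _] := idJ.
by apply/mem_set; exists a => //; exists 0 => //; rewrite addr0.
Qed.

Definition amalg_graph (a : A) : amalg f idJ :=
  exist _ (a, f a) (amalg_graph_subproof a).

Lemma amalg_graph_neq0 (a : A) : a <> 0 -> amalg_graph a <> 0.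
Proof. by move=> nz_a /(congr1 val); rewrite raddf0 => -[]. Qed.

Lemma amalg_ideal_proper (I : set A) :
  is_proper_ideal I -> is_proper_ideal (amalg_ideal f idJ I).
Proof.
case/is_proper_idealP=> -[I0 ID IM] I1; apply/is_proper_idealP; split; last first.
  by move/amalg_idealE; rewrite rmorph1.
split=> [|x y /amalg_idealE Ix /amalg_idealE Iy|a x /amalg_idealE Ix];
  apply/amalg_idealE.
- by rewrite raddf0.
- by rewrite raddfD; apply: ID.
- by rewrite rmorphM; apply: IM.
Qed.

End Projection.

Unset Implicit Arguments.
Set Strict Implicit.

Theorem theorem4p19 (A B : comNzRingType) (f : {rmorphism A -> B})
    (J : set B) (idJ : is_ideal J)
    (I : set A) (properI : is_proper_ideal I) (nzI : I <> [set 0]) :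
  sdf_absorbing (amalg_ideal f idJ I) <-> sdf_absorbing I.
Proof.
split=> [[_ sdfK]|sdfI]; split=> //.
- move=> a b nz_a nz_b Iab.
  have nzga := amalg_graph_neq0 (f := f) (idJ := idJ) nz_a.
  have nzgb := amalg_graph_neq0 (f := f) (idJ := idJ) nz_b.
  have /(sdfK _ _ nzga nzgb) :
      amalg_ideal f idJ I (amalg_graph f idJ a ^+ 2
                           - amalg_graph f idJ b ^+ 2).
    by apply/amalg_idealE; rewrite rmorphB !rmorphXn.
  by case=> /amalg_idealE; rewrite ?raddfB ?raddfD; [left | right].
- exact: amalg_ideal_proper.
- move=> x y _ _ /amalg_idealE.
  rewrite rmorphB !rmorphXn => /(sdf_absorbing_all sdfI nzI).
  by case=> Ixy; [left | right]; apply/amalg_idealE; rewrite ?raddfB ?raddfD.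
Qed.
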